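(* Setting $b=d=g=\ell=q$, $s=xq$, $p=u=x$, and all other parameters ($a,c,f,h,r,t,w$) equal to $1$ in $\mathcal C$, one has $$\mathcal C(z)=1+\sum_{n\ge1}\sum_{\sigma\in\mathcal S_n}x^{\mathsf{des}(\sigma)+1}q^{\mathsf{occ}_{2\text{-}31}(\sigma)}z^n .$$
   Context: $\mathcal S_n$ is the set of permutations of $[n]=\{1,\dots,n\}$. $\mathsf{des}(\sigma)$ is the number of descents of $\sigma$, i.e. of $i\in[n-1]$ with $\sigma(i)>\sigma(i+1)$. $\mathsf{occ}_{2\text{-}31}(\sigma)$ is the number of occurrences of the vincular pattern $2\text{-}31$ in $\sigma$, i.e. the number of pairs $(i,j)$ with $1\le i<j\le n-1$ and $\sigma(j+1)<\sigma(i)<\sigma(j)$. For $n\ge1$, $[n]_{x,y}:=\sum_{i=0}^{n-1}x^{n-1-i}y^{i}$, and $[0]_{x,y}:=0$, with the convention $0^0=1$. For parameters $a,b,c,d,f,g,h,\ell,p,r,s,t,u,w$, $\mathcal C(z)$ is the formal power series in $z$ defined by the continued fraction $$\mathcal C(z)=\cfrac{1}{1-\alpha_0z-\cfrac{\beta_1z^2}{1-\alpha_1z-\cfrac{\beta_2z^2}{\ddots}}},\qquad \alpha_n=u\,w^n+s\,[n]_{a,b}+t\,[n]_{f,g}\ (n\ge 0),\quad \beta_n=p\,r\,[n]_{c,d}\,[n]_{h,\ell}\ (n\ge 1).$$ *)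

(* Defs.v *)
From mathcomp Require Import all_boot all_order all_algebra all_fingroup.

Set Implicit Arguments.
Unset Strict Implicit.
Unset Printing Implicit Defensive.

Import GRing.Theory.
Local Open Scope ring_scope.

(* Letters 1..n are represented by 'I_n = {0..n-1}; both
   statistics below only depend on the relative order of letters and positions. *)

Section Statistics.
Variables (n : nat) (sigma : 'S_n).
Local Open Scope nat_scope.

(* The witness j is the position i+1, which exists only if i is not last. *)
Definition des : nat :=
  #|[set i : 'I_n | [exists j : 'I_n, (j == i.+1 :> nat) && (sigma j < sigma i)]]|.

(* p = (i, j); the witness k is the position j+1. *)
Definition occ_2_31 : nat :=
  #|[set p : 'I_n * 'I_n | (p.1 < p.2) &&
      [exists k : 'I_n, (k == p.2.+1 :> nat) && (sigma k < sigma p.1 < sigma p.2)]]|.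

End Statistics.

(* A formal power series f over R is its sequence of coefficients: f n is the
   coefficient of z^n.  Equality of series is pointwise equality. *)
Definition fps (R : Type) := nat -> R.

Section PowerSeries.
Variable R : comNzRingType.
Implicit Types f g h : fps R.

Definition fps_one : fps R := fun n => (n == 0%N)%:R.
Definition fps_sub f g : fps R := fun n => f n - g n.
Definition fps_mul f g : fps R := fun n => \sum_(i < n.+1) f i * g (n - i)%N.
Definition fps_exp f k : fps R := iter k (fps_mul f) fps_one.

(* 1 / (1 - g) = \sum_k g^k for g without constant term: g^k then contributes
   nothing to the coefficient of z^n as soon as k > n. *)
Definition fps_inv1B g : fps R := fun n => \sum_(k < n.+1) fps_exp g k n.

Lemma fps_exp_small g k n : g 0%N = 0 -> (n < k)%N -> fps_exp g k n = 0.
Proof.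
move=> g0; elim: k n => [//|k IHk] n ltnk.
rewrite /fps_exp iterS -/(fps_exp g k) /fps_mul big1 // => -[[|i] lti] _ /=.
  by rewrite g0 mul0r.
rewrite IHk ?mulr0 //; apply: leq_ltn_trans (leq_sub2l n (ltn0Sn i)) _.
case: n lti ltnk => [//|n] _; by rewrite subn1.
Qed.

Lemma fps_inv1B_widen g n N : g 0%N = 0 -> (n < N)%N ->
  fps_inv1B g n = \sum_(k < N) fps_exp g k n.
Proof.
move=> g0 ltnN; rewrite /fps_inv1B (big_ord_widen N (fun k => fps_exp g k n)) //.
rewrite big_mkcond; apply: eq_bigr => k _; case: ifPn => //.
by rewrite -leqNgt => ltnk; rewrite fps_exp_small.
Qed.

Lemma fps_inv1B_rec g n : g 0%N = 0 ->
  fps_inv1B g n = fps_one n + fps_mul g (fps_inv1B g) n.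
Proof.
move=> g0; rewrite (@fps_inv1B_widen g n n.+2) // big_ord_recl; congr (_ + _).
rewrite /fps_mul.
under [RHS]eq_bigr => i _.
  rewrite (@fps_inv1B_widen g _ n.+1) ?ltnS ?leq_subr // big_distrr /=; over.
by rewrite exchange_big.
Qed.

Lemma fps_inv1BP g : g 0%N = 0 ->
  fps_mul (fps_sub fps_one g) (fps_inv1B g) =1 fps_one.
Proof.
move=> g0 n; rewrite /fps_mul /fps_sub.
under eq_bigr => i _ do rewrite mulrBl.
rewrite sumrB big_ord_recl big1 => [|i _]; last by rewrite mul0r.
by rewrite mul1r addr0 subn0 fps_inv1B_rec // addrK.
Qed.

End PowerSeries.

Section JFraction.
Variable R : comNzRingType.
Variables alpha beta : nat -> R.

(* a z + b z^2 T(z) *)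
Definition jlevel (a b : R) (T : fps R) : fps R := fun n =>
  match n with 0 => 0 | 1 => a | m.+2 => b * T m end.

(* The continued fraction starting at level k, cut after m levels:
   1/(1 - alpha_k z - beta_{k+1} z^2/(1 - alpha_{k+1} z - ...)).  The fraction
   with no level at all is 0. *)
Fixpoint jconvergent (m k : nat) : fps R :=
  if m is m'.+1 then
    fps_inv1B (jlevel (alpha k) (beta k.+1) (jconvergent m' k.+1))
  else fun=> 0.

(* The infinite fraction is the z-adic limit of its convergents; see
   jconvergent_jfrac. *)
Definition jfrac : fps R := fun n => jconvergent n.+1 0 n.

Lemma jconvergent_stable m m' k n : (n < m)%N -> (n < m')%N ->
  jconvergent m k n = jconvergent m' k n.
Proof.
elim: m m' k n => [//|m IHm] [//|m'] k n; rewrite !ltnS /=.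
elim/ltn_ind: n => n IHn lenm lenm'; rewrite !fps_inv1B_rec //.
congr (_ + _); apply: eq_bigr => -[[|[|i]] lti] _ /=; first by rewrite !mul0r.
  rewrite IHn //.
  - by rewrite subn1 prednK.
  - by rewrite (leq_trans _ lenm) ?leq_subr.
  - by rewrite (leq_trans _ lenm') ?leq_subr.
have lti' : (i < n)%N by apply: ltn_trans (ltnSn i) _.
have n0 : (0 < n)%N by apply: leq_ltn_trans lti'.
rewrite (IHm m') ?(leq_trans lti') // IHn //.
- by rewrite ltn_subrL n0.
- by rewrite (leq_trans _ lenm) ?leq_subr.
- by rewrite (leq_trans _ lenm') ?leq_subr.
Qed.

Lemma jconvergent_jfrac m n : (n < m)%N -> jconvergent m 0 n = jfrac n.
Proof. by move=> ltnm; apply: jconvergent_stable. Qed.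

End JFraction.

Section CFraction.
Variable R : comNzRingType.

(* [n]_{x,y}; in particular it is 0 for n = 0, and 0 ^+ 0 = 1. *)
Definition bracket (n : nat) (x y : R) : R :=
  \sum_(0 <= i < n) x ^+ (n - 1 - i) * y ^+ i.

(* Field pX holds the parameter named X, with pl for the letter ell. *)
Record cparams := CParams {
  pa : R; pb : R; pc : R; pd : R; pf : R; pg : R; ph : R; pl : R;
  pp : R; pr : R; ps : R; pt : R; pu : R; pw : R }.

Definition calpha (P : cparams) (n : nat) : R :=
  pu P * pw P ^+ n + ps P * bracket n (pa P) (pb P) + pt P * bracket n (pf P) (pg P).

Definition cbeta (P : cparams) (n : nat) : R :=
  pp P * pr P * bracket n (pc P) (pd P) * bracket n (ph P) (pl P).

Definition Cfrac (P : cparams) : fps R := jfrac (calpha P) (cbeta P).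

End CFraction.

(* Main.v *)
(* Write [k] = 1 + q + ... + q^(k-1).  Insert the letters of a permutation in
   increasing order: the letters present at a given time form k blocks of
   adjacent positions, and the letter v is the "2" of as many occurrences of
   2-31 as there are blocks to the right of v just after its insertion.  Hence
   the weighted number W_n(k) of states after n insertions satisfies
     W_(n+1)(k) = [k] (W_n(k-1) + (1 + x) W_n(k) + x W_n(k+1)),
   and W_n(1) is the distribution of (des, 2-31) on S_n.  The combination
   V_n(k) = W_n(k) + x W_n(k+1) counts Motzkin paths ending at level k with
   weights [k] for the rise to level k, [k] + x [k+1] for a level step and
   x [k+1] for the fall to level k, so that V_n(0) = x W_n(1) is the coefficient
   of z^n in the continued fraction. *)

Require Import Defs.
From mathcomp Require Import all_boot all_order all_algebra all_fingroup ring.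
Set Implicit Arguments.
Unset Strict Implicit.
Unset Printing Implicit Defensive.
Import GRing.Theory.
Local Open Scope ring_scope.

(** * Continued fractions as generating functions of Motzkin paths *)

Section JFractionPaths.
Variable R : comNzRingType.
Implicit Types f g h : fps R.

Lemma fps_mul_coefM f g (p r : {poly R}) n :
  (forall i, (i <= n)%N -> p`_i = f i) -> (forall i, (i <= n)%N -> r`_i = g i) ->
  fps_mul f g n = (p * r)`_n.
Proof.
move=> pf rg; rewrite coefM; apply: eq_bigr => i _.
by rewrite pf ?rg ?leq_subr // -ltnS.
Qed.

Lemma fps_mulA f g h : fps_mul f (fps_mul g h) =1 fps_mul (fps_mul f g) h.
Proof.
(* Coefficients up to n depend only on truncations, for which associativity is that of
   polynomials. *)
move=> n; pose P e := \poly_(i < n.+1) e i : {poly R}.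
have PE e i : (i <= n)%N -> (P e)`_i = e i by move=> lein; rewrite coef_poly ltnS lein.
have PM e1 e2 i : (i <= n)%N -> (P e1 * P e2)`_i = fps_mul e1 e2 i.
  by move=> lein; rewrite -(@fps_mul_coefM e1 e2 (P e1) (P e2)) // => j leji;
    apply: PE; apply: leq_trans lein.
rewrite (@fps_mul_coefM _ _ (P f) (P g * P h)); [|exact: PE|exact: PM].
by rewrite mulrA -(@fps_mul_coefM (fps_mul f g) h) //; [exact: PM | exact: PE].
Qed.

Lemma eq_fps_mul f f' g g' : f =1 f' -> g =1 g' -> fps_mul f g =1 fps_mul f' g'.
Proof. by move=> ff gg n; apply: eq_bigr => i _; rewrite ff gg. Qed.

Definition fps_shift (c : R) f : fps R := fun n => if n is m.+1 then c * f m else 0.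

Lemma fps_mul_shift c f g : fps_mul f (fps_shift c g) =1 fps_shift c (fps_mul f g).
Proof.
case=> [|n]; first by rewrite /fps_mul big_ord_recl big_ord0 mulr0 addr0.
rewrite /fps_mul big_ord_recr /= subnn mulr0 addr0 big_distrr /=.
by apply: eq_bigr => i _; rewrite subSn ?leq_ord //= mulrCA.
Qed.

Section Tail.
Variables alpha beta : nat -> R.

(** The fraction that starts at level [k]: it counts the paths from [k] back to [k] that never go
    below [k]. *)
Definition jtail k : fps R := fun n => jconvergent alpha beta n.+1 k n.

Lemma jtail_rec k n : jtail k n =
  fps_one R n + fps_mul (jlevel (alpha k) (beta k.+1) (jtail k.+1)) (jtail k) n.
Proof.
pose J := jconvergent alpha beta.
have stab l m i : (i < m)%N -> J m l i = jtail l i.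
  by move=> ltim; apply: jconvergent_stable.
rewrite -(stab k n.+2) // [LHS]fps_inv1B_rec //; congr (_ + _).
apply: eq_bigr => i _; congr (_ * _).
  case: i => -[|[|i]] // lti.
  rewrite -[LHS]/(beta k.+1 * J n.+1 k.+1 i) stab //.
  by apply: ltnW; apply: ltnW.
by rewrite -(stab k n.+2) // (leq_ltn_trans (leq_subr _ _)) // ltnS leqnSn.
Qed.

Variables (u d : nat -> R) (V : nat -> nat -> R).
Hypotheses (u0 : u 0 = 0) (betaE : forall k, beta k.+1 = d k * u k.+1).
Hypothesis V0 : forall k, V 0 k = (k == 0)%:R.
Hypothesis VS : forall n k,
  V n.+1 k = u k * V n k.-1 + alpha k * V n k + d k * V n k.+1.

(* Weighted paths from level 0 to level k, decomposed at the last step to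
   each of the levels 1, ..., k. *)
Fixpoint jpath k : fps R :=
  if k is k'.+1 then fps_mul (jtail k) (fps_shift (u k) (jpath k')) else jtail 0.

Lemma jpath0 k : jpath k 0 = (k == 0)%:R.
Proof.
case: k => [|k] /=.
  by rewrite jtail_rec /fps_mul big_ord_recl big_ord0 mul0r !addr0.
by rewrite /fps_mul big_ord_recl big_ord0 mulr0 addr0.
Qed.

(** Since T = [jtail k] satisfies T = 1 + [L] T, also [jpath k] = [G] + [L] * [jpath k]. Here [G] is
    a last step rising to [k]; in [L], the z^2 term, with its coefficient split by [betaE], turns
    into a fall from [jpath k.+1]. *)
Lemma jpathS n k :
  jpath k n.+1 = u k * jpath k.-1 n + alpha k * jpath k n + d k * jpath k.+1 n.
Proof.
pose G := if k is k'.+1 then fps_shift (u k) (jpath k') else fps_one R.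
have mul1 f : fps_mul (fps_one R) f =1 f.
  move=> m; rewrite /fps_mul big_ord_recl subn0 mul1r big1 ?addr0 // => i _.
  by rewrite mul0r.
have mulr1 f : fps_mul f (fps_one R) =1 f.
  move=> m; rewrite /fps_mul big_ord_recr /= subnn mulr1 big1 ?add0r // => i _.
  by rewrite /fps_one subn_eq0 leqNgt ltn_ord mulr0.
have jE : jpath k =1 fps_mul (jtail k) G.
  by rewrite /G; case: k {G} => [|k] m //=; rewrite mulr1.
pose L := jlevel (alpha k) (beta k.+1) (jtail k.+1).
have jR m : jpath k m = G m + fps_mul L (jpath k) m.
  rewrite jE (eq_fps_mul (jtail_rec k) (frefl G)).
  rewrite (eq_fps_mul (frefl L) jE) fps_mulA -[G m](mul1 G).
  rewrite /fps_mul -big_split /=; apply: eq_bigr => i _; exact: mulrDl.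
rewrite jR -addrA; congr (_ + _).
  (* At level 0, [k.-1] is again 0; [u0] removes this spurious rise. *)
  by rewrite /G; case: k {G jE L jR} => [|k] //=; rewrite u0 mul0r.
rewrite /= fps_mul_shift.
case: n => [|n] /=.
  by rewrite /fps_mul !big_ord_recl big_ord0 /= mul0r mulr0 add0r addr0.
rewrite /fps_mul 2!big_ord_recl /= mul0r add0r subn1 /=; congr (_ + _).
rewrite !big_distrr /=; apply: eq_bigr => i _.
rewrite /bump /= !add1n betaE subSS; ring.
Qed.

Lemma jfrac_path n : jfrac alpha beta n = V n 0.
Proof.
suff E k : jpath k n = V n k by exact: (E 0).
elim: n k => [|n IHn] k; first by rewrite jpath0 V0.
by rewrite jpathS VS !IHn.
Qed.

End Tail.
End JFractionPaths.

(** * Compositions into blocks and the recurrence for W_n(k) *)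

Section Compositions.
Variables (R : comNzRingType) (x q : R).

Lemma bracket0 : bracket 0 1 q = 0.
Proof. by rewrite /bracket big_geq. Qed.

Lemma bracketS n : bracket n.+1 1 q = bracket n 1 q + q ^+ n.
Proof.
rewrite /bracket big_nat_recr //= expr1n mul1r; congr (_ + _).
by apply: eq_bigr => i _; rewrite !expr1n.
Qed.

Lemma bracketSl n : bracket n.+1 1 q = 1 + q * bracket n 1 q.
Proof.
elim: n => [|n IHn]; first by rewrite bracketS bracket0 mulr0 add0r addr0.
by rewrite bracketS {1}IHn bracketS mulrDr addrA -exprS.
Qed.

(** Sum of [G] over the compositions of [m] into [k] positive parts. *)
Fixpoint comp_sum (m k : nat) (G : seq nat -> R) : R :=
  if k is k'.+1 then \sum_(a < m) comp_sum (m - a.+1) k' (fun c => G (a.+1 :: c))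
  else (m == 0)%:R * G [::].

Notation nz := (count (leq 1)).

Lemma eq_comp_sum m k G G' :
  (forall c, size c = k -> nz c = k -> G c = G' c) ->
  comp_sum m k G = comp_sum m k G'.
Proof.
elim: k m G G' => [|k IHk] m G G' eqG /=; first by rewrite eqG.
by apply: eq_bigr => a _; apply: IHk => c sc nc; apply: eqG; rewrite /= ?sc ?nc.
Qed.

Lemma comp_sumD m k G G' :
  comp_sum m k (fun c => G c + G' c) = comp_sum m k G + comp_sum m k G'.
Proof.
elim: k m G G' => [|k IHk] m G G' /=; first exact: mulrDr.
by rewrite -big_split /=; apply: eq_bigr => a _; apply: IHk.
Qed.

Lemma comp_sumZ m k z G : comp_sum m k (fun c => z * G c) = z * comp_sum m k G.
Proof.
elim: k m G => [|k IHk] m G /=; first exact: mulrCA.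
by rewrite big_distrr /=; apply: eq_bigr => a _; apply: IHk.
Qed.

Lemma comp_sum_sum m k n (G : nat -> seq nat -> R) :
  comp_sum m k (fun c => \sum_(i < n) G i c) = \sum_(i < n) comp_sum m k (G i).
Proof.
elim: k m G => [|k IHk] m G /=; first exact: big_distrr.
by rewrite exchange_big /=; apply: eq_bigr => a _; apply: (IHk _ (fun i c => G i (_ :: c))).
Qed.

(* The parts are the sizes of the blocks; zero parts are harmless.  Removing the
   largest letter, when i letters of its block precede it, splits a block of
   size a into blocks of sizes i and a - i - 1. *)
Fixpoint del (G : seq nat -> R) (c : seq nat) : R :=
  if c is a :: c' then
    q ^+ nz c' * \sum_(i < a) x ^+ (i.+1 < a)%N * G [:: (i : nat), (a - i.+1)%N & c']
    + del (fun e => G (a :: e)) c'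
  else 0.

Fixpoint fillings m c : R := if m is m'.+1 then del (fillings m') c else 1.

(** Removing the first or last letter of a block leaves an empty block, which must not count. *)
Definition zero_inv (G : seq nat -> R) := forall c, G c = G (filter (leq 1) c).

Lemma zero_inv0 G c1 c2 : zero_inv G -> G (c1 ++ 0%N :: c2) = G (c1 ++ c2).
Proof. by move=> zG; rewrite zG [RHS]zG !filter_cat. Qed.

Lemma zero_inv_cons G a : zero_inv G -> zero_inv (fun c => G (a :: c)).
Proof.
move=> zG c; rewrite zG [RHS]zG /=.
by case: ifP; rewrite filter_id.
Qed.

Lemma eq_del G G' : G =1 G' -> del G =1 del G'.
Proof.
move=> eqG c; elim: c G G' eqG => [|a c IHc] G G' eqG //=.
rewrite (IHc _ (fun e => G' (a :: e))) //; congr (_ * _ + _).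
by apply: eq_bigr => i _; rewrite eqG.
Qed.

Lemma del_zero_inv G : zero_inv G -> zero_inv (del G).
Proof.
move=> zG c; elim: c G zG => [//|a c IHc] G zG.
rewrite [filter _ _]/=; case: a => [|a] /=.
  rewrite big_ord0 mulr0 add0r -IHc //; apply: eq_del => e.
  exact: (@zero_inv0 _ [::]).
rewrite count_filter; congr (_ * _ + _).
- by congr (_ ^+ _); apply: eq_count => i /=; rewrite andbb.
- by apply: eq_bigr => i _; rewrite zG [in RHS]zG /= filter_id.
- by apply: IHc; apply: zero_inv_cons.
Qed.

Lemma fillings_zero_inv m : zero_inv (fillings m).
Proof. by elim: m => [|m IHm] c //=; apply: del_zero_inv. Qed.

Lemma comp_sum0_del k G : comp_sum 0 k (del G) = 0.
Proof. by case: k => [|k] /=; rewrite ?mulr0 ?big_ord0. Qed.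

(* The letter put back is a new part, starts or ends an existing part, or
   joins two parts. *)
Lemma comp_sum_del_head m k G : zero_inv G ->
  \sum_(a < m.+1) comp_sum (m - a) k
     (fun c => \sum_(i < a.+1) x ^+ (i < a)%N * G [:: (i : nat), (a - i)%N & c])
  = comp_sum m k G + (1 + x) * comp_sum m k.+1 G + x * comp_sum m k.+2 G.
Proof.
move=> zG.
transitivity (\sum_(a < m.+1) \sum_(i < a.+1)
    x ^+ (i < a)%N * comp_sum (m - a) k (fun c => G [:: (i : nat), (a - i)%N & c])).
  apply: eq_bigr => a _.
  rewrite (comp_sum_sum _ _ _ (fun i c => x ^+ (i < a)%N * G [:: i, (a - i)%N & c])).
  by apply: eq_bigr => i _; rewrite comp_sumZ.
rewrite big_ord_recl /= subn0 big_ord_recl big_ord0 mul1r addr0 -addrA.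
congr (_ + _).
  by apply: eq_comp_sum => c _ _; rewrite (@zero_inv0 _ [::]) // (@zero_inv0 _ [::]).
transitivity (\sum_(a < m) ((1 + x) * comp_sum (m - a.+1) k (fun c => G (a.+1 :: c))
   + x * \sum_(i < a) comp_sum (m - a.+1) k (fun c => G [:: i.+1, (a - i)%N & c]))).
  apply: eq_bigr => a _; rewrite /bump /= add1n.
  rewrite big_ord_recl big_ord_recr /= ltnn subnn subn0 expr0 mul1r.
  rewrite (@eq_comp_sum _ _ (fun c => G [:: 0%N, a.+1 & c]) (fun c => G (a.+1 :: c))); last first.
    by move=> c _ _; apply: (@zero_inv0 _ [::]).
  rewrite (@eq_comp_sum _ _ (fun c => G [:: bump 0 a, 0%N & c]) (fun c => G (a.+1 :: c))); last first.
    by move=> c _ _; apply: (@zero_inv0 _ [:: _]).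
  rewrite expr1 big_distrr /= mulrDl mul1r addrCA addrC; congr (_ + _).
    exact: addrC.
  by apply: eq_bigr => i _; rewrite /bump /= !add1n ltnS ltn_ord expr1 subSS.
rewrite big_split /= -!big_distrr /=; congr (_ + _ * _).
(* With i outermost, i + 1 and a - i become the two leading parts of a composition. *)
transitivity (\sum_(i < m) \sum_(a < m | (i < a)%N)
   comp_sum (m - a.+1) k (fun c => G [:: i.+1, (a - i)%N & c])).
  rewrite (exchange_big_dep predT) //=; apply: eq_bigr => a _.
  by rewrite (big_ord_widen _ (fun i => comp_sum (m - a.+1) k (fun c => G [:: i.+1, (a - i)%N & c])) (ltnW (ltn_ord a))).
apply: eq_bigr => i _.
rewrite -(big_mkord (fun a => i < a)%N (fun a => comp_sum (m - a.+1) k (fun c => G [:: i.+1, (a - i)%N & c]))).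
rewrite (@big_cat_nat _ _ _ i.+1) //= big_nat_cond big1 ?add0r; last first.
  by move=> a /andP[/andP[_]]; rewrite ltnS leqNgt => /negbTE->.
rewrite -{1}[i.+1]add0n big_addn big_mkcond /= big_mkord.
apply: eq_bigr => a _; rewrite leq_addl -subnDA addnS subSn ?leq_addl // addnK.
by rewrite addSnnS addnC !addnS.
Qed.

(** Induction along [k+1] = [k] + q^k: a letter removed from the first of k + 1 parts has k parts to
    its right, and removal from a later part is the induction hypothesis on the tail. *)
Lemma comp_sum_del m k G : zero_inv G ->
  comp_sum m.+1 k (del G) = bracket k 1 q *
    (comp_sum m k.-1 G + (1 + x) * comp_sum m k G + x * comp_sum m k.+1 G).
Proof.
elim: k m G => [|k IHk] m G zG; first by rewrite /= bracket0 !mul0r.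
rewrite [k.+1.-1]/= bracketS mulrDl addrC.
have -> : bracket k 1 q * (comp_sum m k G + (1 + x) * comp_sum m k.+1 G
             + x * comp_sum m k.+2 G)
   = \sum_(a < m.+1) comp_sum (m - a) k (del (fun c => G (a.+1 :: c))).
  rewrite big_ord_recr /= subnn comp_sum0_del addr0.
  case: k IHk => [|k] IHk.
    rewrite bracket0 mul0r big1 // => a _.
    exact: mulr0.
  rewrite !big_distrr /= -!big_split big_distrr /=; apply: eq_bigr => a _.
  rewrite -(subnSK (ltn_ord a)).
  rewrite -[RHS]/(comp_sum _ k.+1 (del (fun c => G (a.+1 :: c)))) IHk //.
rewrite -comp_sum_del_head // big_distrr -big_split /=.
apply: eq_bigr => a _; rewrite subSS comp_sumD; congr (_ + _).
by rewrite -comp_sumZ; apply: eq_comp_sum => c _ ->.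
Qed.

Definition words n k := comp_sum n k (fillings n).

Lemma wordsS n k : words n.+1 k =
  bracket k 1 q * (words n k.-1 + (1 + x) * words n k + x * words n k.+1).
Proof. exact/comp_sum_del/fillings_zero_inv. Qed.

Lemma words0 k : words 0 k = (k == 0)%:R.
Proof. by case: k => [|k]; rewrite /words /= ?mulr1 ?big_ord0. Qed.

Lemma words1 n : (0 < n)%N -> words n 1 = fillings n [:: n].
Proof.
case: n => // n _; rewrite /words [LHS]/= big_ord_recr subnn mul1r big1 /=.
  exact: add0r.
by move=> i _; rewrite subSS subn_eq0 leqNgt ltn_ord mul0r.
Qed.

End Compositions.

(** * Words of filled positions *)

Section Words.
Variables (R : comNzRingType) (x q : R).

(* A word marks the positions filled so far. *)
Fixpoint ups (b : bitseq) : nat :=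
  if b is e :: b' then (~~ e && head false b') + ups b' else 0.

(** Counterpart of [del] on words. The removed letter is the largest present, so a filled next
    position makes a descent, and [ups b'] counts the blocks to its right, that is, its occurrences
    as the 2 of 2-31. *)
Fixpoint erase (G : bitseq -> R) (b : bitseq) : R :=
  if b is e :: b' then
    (if e then x ^+ head false b' * q ^+ ups b' * G (false :: b') else 0)
    + erase (fun d => G (e :: d)) b'
  else 0.

Lemma eq_erase G G' : G =1 G' -> erase G =1 erase G'.
Proof.
move=> eqG b; elim: b G G' eqG => [//|e b IHb] G G' eqG /=.
by rewrite eqG (IHb _ (fun d => G' (e :: d))).
Qed.

Lemma eraseE G b : erase G b =
  \sum_(p < size b) (if nth false b p then
    x ^+ nth false b p.+1 * q ^+ ups (drop p.+1 b) * G (set_nth false b p false)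
  else 0).
Proof.
elim: b G => [|e b IHb] G /=; first by rewrite big_ord0.
by rewrite big_ord_recl /= drop0 IHb nth0.
Qed.

(** Every block ends with an unfilled position, so that an erased position serves as the separator
    of the two blocks it creates. *)
Fixpoint runs_word (c : seq nat) : bitseq :=
  if c is a :: c' then nseq a true ++ false :: runs_word c' else [::].

Lemma ups_runs_word a c :
  ups (nseq a true ++ false :: runs_word c) = count (leq 1) c.
Proof.
have ups_nseq b w : ups (nseq b true ++ false :: w) = (head false w + ups w)%N.
  by elim: b.
rewrite ups_nseq; elim: c => //= b c <-; rewrite ups_nseq.
by case: b.
Qed.

Lemma erase_runs_word G c :
  erase G (runs_word c) = del x q (fun e => G (runs_word e)) c.
Proof.
elim: c G => [//|a c IHc] G /=.
(* [H] is arbitrary so that the induction on [a] can absorb the bits already passed. *)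
suff run H : erase H (nseq a true ++ false :: runs_word c) =
    q ^+ count (leq 1) c * (\sum_(i < a) x ^+ (i.+1 < a)%N *
      H (nseq i true ++ false :: nseq (a - i.+1) true ++ false :: runs_word c))
    + erase (fun d => H (nseq a true ++ false :: d)) (runs_word c).
  by rewrite run IHc.
elim: a H => [|a IHa] H /=; first by rewrite big_ord0 mulr0.
rewrite big_ord_recl IHa ups_runs_word subSS subn0 mulrDr addrA /=.
congr (_ + _ + _).
by rewrite mulrCA mulrA; congr (_ * _ ^+ _ * _); case: a {IHa}.
Qed.

Fixpoint erasures m b : R := if m is m'.+1 then erase (erasures m') b else 1.

Lemma erasures_runs_word m c : erasures m (runs_word c) = fillings x q m c.
Proof.
elim: m c => [//|m IHm] c /=; rewrite erase_runs_word; exact: eq_del.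
Qed.

Definition filled N (t : seq nat) : bitseq := mkseq (fun j => j \in t) N.

Definition crossings N (p : nat) (t : seq nat) : nat :=
  count (fun j => [&& (p < j)%N, j \notin t & j.+1 \in t]) (iota 0 N).

(* The list t holds the positions of the letters, from the largest letter down. *)
Fixpoint order_weight N (t : seq nat) : R :=
  if t is p :: t' then
    x ^+ (p.+1 \in t') * q ^+ crossings N p t' * order_weight N t'
  else 1.

(** [ups] treats the position after the end of the word as unfilled; the hypothesis makes [f]
    agree. *)
Lemma ups_mkseq (f : nat -> bool) m N : f (m + N)%N = false ->
  ups [seq f j | j <- iota m N] = count (fun j => ~~ f j && f j.+1) (iota m N).
Proof.
elim: N m => [//|N IHN] m fN /=; rewrite IHN ?addSnnS //; congr (_ + _).
by case: N fN {IHN} => [|N] //=; rewrite addn1 => ->.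
Qed.

(** Induction on the number of letters: an ordering of [s] is a head [p], the position of the
    largest letter, followed by an ordering of [rem p s], and [erase] clears bit [p]. As p + 1 < N,
    the last bit is never set. *)
Lemma sum_order_weight N s : uniq s -> {in s, forall p, (p.+1 < N)%N} ->
  \sum_(t <- permutations s) order_weight N t = erasures (size s) (filled N s).
Proof.
move sz_s: (size s) => m; elim: m s sz_s => [|m IHm] s sz_s us sN.
  by rewrite (size0nil sz_s) /= big_seq1.
rewrite (perm_big _ (permutationsE _)) ?sz_s // undup_id // big_allpairs_dep /=.
rewrite eraseE size_mkseq -(big_mkord predT (fun p => if nth false (filled N s) p then
   x ^+ nth false (filled N s) p.+1 * q ^+ ups (drop p.+1 (filled N s)) *
   erasures m (set_nth false (filled N s) p false) else 0)).
rewrite -big_mkcond -[RHS]big_filter.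
have perm_s : perm_eq s [seq p <- index_iota 0 N | nth false (filled N s) p].
  apply: uniq_perm => //; first by rewrite filter_uniq ?iota_uniq.
  move=> p; rewrite mem_filter mem_index_iota /=.
  have [ltpN|leNp] := ltnP p N; first by rewrite nth_mkseq // andbT.
  rewrite andbF; apply/negP => /sN ltpN.
  by rewrite ltnNge (leq_trans leNp) ?leqnSn in ltpN.
rewrite -(perm_big _ perm_s) /= !big_seq; apply: eq_bigr => p ps.
have ltpN := sN p ps.
have mem_t t : t \in permutations (rem p s) -> t =i [predD1 s & p].
  by rewrite mem_permutations => /perm_mem tE j; rewrite tE mem_rem_uniq.
(* Putting [p] back changes no exponent: it differs from p + 1 and from all j, j + 1 with j > p. *)
transitivity (\sum_(t <- permutations (rem p s))
  x ^+ (p.+1 \in s) * q ^+ crossings N p s * order_weight N t).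
  apply: eq_big_seq => t /mem_t tE; rewrite tE inE /= gtn_eqF //=.
  congr (_ * q ^+ _ * _); apply: eq_count => j; rewrite !tE !inE.
  case: (ltnP p j) => //= ltpj.
  by rewrite !gtn_eqF // ltnS ltnW.
rewrite -big_distrr /= IHm ?rem_uniq //; first last.
- by move=> j /mem_rem; apply: sN.
- by rewrite size_rem // sz_s.
congr (_ * _ * _).
- by rewrite nth_mkseq.
- congr (_ ^+ _); rewrite /filled /mkseq -map_drop drop_iota add0n ups_mkseq; last first.
    by rewrite subnKC ?(ltnW ltpN) //; apply/negP => /sN; rewrite ltnNge leqnSn.
  rewrite /crossings -[in iota 0 N](subnKC (ltnW ltpN)) iotaD add0n count_cat.
  rewrite (@eq_in_count _ _ pred0) ?count_pred0 ?add0n.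
    by apply: eq_in_count => j; rewrite mem_iota => /andP[-> _].
  by move=> j; rewrite mem_iota add0n ltnS ltnNge => /= ->.
- congr (erasures _ _); apply: (@eq_from_nth _ false).
    by rewrite size_set_nth !size_mkseq; apply/esym/maxn_idPr/ltnW.
  move=> j; rewrite size_mkseq => ltjN; rewrite nth_set_nth /= !nth_mkseq //.
  by rewrite mem_rem_uniq // inE /=; case: eqP.
Qed.

Lemma sum_order_weight_iota n :
  \sum_(t <- permutations (iota 0 n)) order_weight n.+1 t = fillings x q n [:: n].
Proof.
rewrite sum_order_weight ?iota_uniq //; last first.
  by move=> p; rewrite mem_iota ltnS.
rewrite size_iota -erasures_runs_word; congr erasures.
rewrite /filled /mkseq -addn1 iotaD map_cat /= mem_iota ltnn.
congr (_ ++ _); apply/(@eq_from_nth _ false).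
  by rewrite size_map size_iota size_nseq.
move=> i; rewrite size_map size_iota => ltin.
by rewrite (nth_map 0%N) ?size_iota // nth_iota // mem_iota nth_nseq ltin.
Qed.

Lemma order_weight_rev_mkseq N (g : nat -> nat) m :
  order_weight N (rev (mkseq g m)) = \prod_(v < m)
    (x ^+ ((g v).+1 \in mkseq g v) * q ^+ crossings N (g v) (mkseq g v)).
Proof.
elim: m => [|m IHm]; first by rewrite big_ord0.
rewrite mkseqS rev_rcons big_ord_recr /= IHm mulrC mem_rev; congr (_ * (_ * q ^+ _)).
by apply: eq_count => j; rewrite !mem_rev.
Qed.

(** * Permutations as filling orders *)

Section Perm.
Variable n : nat.
Implicit Type sigma : 'S_n.

Definition pos_of sigma (v : nat) : nat :=
  if insub v is Some i then (sigma^-1)%g i : nat else 0.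

Definition fill_order sigma : seq nat := rev (mkseq (pos_of sigma) n).

Lemma pos_ofE sigma (i : 'I_n) : pos_of sigma (sigma i) = i.
Proof. by rewrite /pos_of valK permK. Qed.

Lemma mem_pos_of sigma (v : 'I_n) j :
  (j \in mkseq (pos_of sigma) v) = [exists k : 'I_n, (k == j :> nat) && (sigma k < v)%N].
Proof.
apply/mapP/existsP => [[u]|[k /andP[/eqP <- ltkv]]].
  rewrite mem_iota /= => ltuv ->; have ltun := ltn_trans ltuv (ltn_ord v).
  by exists ((sigma^-1)%g (Ordinal ltun)); rewrite permKV /pos_of insubT eqxx.
by exists (sigma k : nat); rewrite ?mem_iota ?pos_ofE.
Qed.

(** Reindexing by v = sigma i turns the product over letters into one over positions: i + 1 filled
    before i is a descent, and an unfilled j > i holds a letter above sigma i. *)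
Lemma order_weight_fill sigma :
  order_weight n.+1 (fill_order sigma) = x ^+ des sigma * q ^+ occ_2_31 sigma.
Proof.
rewrite order_weight_rev_mkseq (reindex_inj (@perm_inj _ sigma)) /=.
rewrite big_split /= -!expr_sum; congr (_ ^+ _ * _ ^+ _).
  rewrite /des cardsE -sum1_card [RHS]big_mkcond /=; apply: eq_bigr => i _.
  by rewrite pos_ofE mem_pos_of unfold_in; case: ifP.
rewrite /occ_2_31 cardsE -sum1_card (eq_bigl (fun p : 'I_n * 'I_n =>
   predT p.1 && [&& (p.1 < p.2)%N & [exists k : 'I_n, (k == p.2.+1 :> nat) &&
     (sigma k < sigma p.1 < sigma p.2)%N]])) //.
rewrite -(pair_big_dep predT (fun i j : 'I_n => (i < j)%N && [exists k : 'I_n,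
   (k == j.+1 :> nat) && (sigma k < sigma i < sigma j)%N]) (fun _ _ => 1%N)) /=.
apply: eq_bigr => i _; rewrite pos_ofE sum1_card.
(* The index j = n drops out, since n + 1 is never filled. *)
rewrite /crossings -[n.+1]addn1 iotaD count_cat /= addn0 add0n.
have -> : [&& (i < n)%N, n \notin mkseq (pos_of sigma) (sigma i)
   & n.+1 \in mkseq (pos_of sigma) (sigma i)] = false.
  apply/negP => /and3P[_ _]; rewrite mem_pos_of => /existsP[k /andP[/eqP kn _]].
  by have := ltn_ord k; rewrite kn ltnNge leqnSn.
rewrite addn0 -val_enum_ord count_map cardE size_filter.
rewrite -enumT; apply: eq_count => j /=; rewrite !mem_pos_of /in_mem /=.
case: (ltnP i j) => //= ltij.
have -> : [exists k : 'I_n, (k == j :> nat) && (sigma k < sigma i)%N] = (sigma j < sigma i)%N.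
  apply/existsP/idP => [[k /andP[/eqP/val_inj -> //]]|ltji].
  by exists j; rewrite eqxx.
have -> : (sigma j < sigma i)%N = ~~ (sigma i < sigma j)%N.
  rewrite -leqNgt [RHS]leq_eqVlt; case: eqP => // /val_inj/perm_inj ij.
  by rewrite ij ltnn in ltij.
rewrite negbK; apply/andP/existsP => [[ltji /existsP[k /andP[kj ltki]]]|].
  by exists k; rewrite kj ltki.
by case=> k /and3P[kj ltki ltij']; split=> //; apply/existsP; exists k; rewrite kj.
Qed.

(** [fill_order] is injective into the orderings of 0, ..., n - 1, hence onto because both sides
    have n! elements. *)
Lemma sum_perm_weight :
  \sum_(sigma : 'S_n) x ^+ des sigma * q ^+ occ_2_31 sigma = fillings x q n [:: n].
Proof.
rewrite -sum_order_weight_iota.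
under eq_bigr => sigma _ do rewrite -order_weight_fill.
rewrite -big_enum -[LHS](big_map fill_order predT) /=; apply: perm_big.
have inj : injective fill_order.
  move=> s1 s2 /(can_inj revK) e; apply/permP => i; apply/(@perm_inj _ s2^-1%g).
  rewrite permK; apply/val_inj; rewrite /= -(pos_ofE s1 i).
  have := congr1 (nth 0%N ^~ (s1 i)) e; rewrite !nth_mkseq // => ->.
  by rewrite /pos_of valK.
have u1 : uniq [seq fill_order s | s <- enum 'S_n] by rewrite map_inj_uniq ?enum_uniq.
apply: uniq_perm => //; first exact: permutations_uniq.
have sub : {subset [seq fill_order s | s <- enum 'S_n] <= permutations (iota 0 n)}.
  move=> _ /mapP[s _ ->]; rewrite mem_permutations perm_rev /mkseq -val_enum_ord -map_comp.
  rewrite (@eq_map _ _ _ (val \o (s^-1)%g)) => [|i /=]; last by rewrite /pos_of valK.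
  rewrite map_comp perm_map //; apply: uniq_perm; rewrite ?enum_uniq //.
    by rewrite map_inj_uniq ?enum_uniq //; apply: perm_inj.
  move=> i; rewrite mem_enum; apply/mapP; exists (s i); first exact: mem_enum.
  by rewrite permK.
suff sz : (size (permutations (iota 0 n)) <= size [seq fill_order s | s <- enum 'S_n])%N.
  exact: (uniq_min_size u1 sub sz).2.
by rewrite size_permutations ?iota_uniq // size_iota size_map -cardE card_Sn.
Qed.
End Perm.
End Words.

Theorem corollary6 (R : comNzRingType) (x q : R) :
  Cfrac {| pb := q; pd := q; pg := q; pl := q;
           ps := x * q;
           pp := x; pu := x;
           pa := 1; pc := 1; pf := 1; ph := 1; pr := 1; pt := 1; pw := 1 |}
  =1 (fun n : nat =>
        if n == 0%N then 1
        else \sum_(sigma : 'S_n) x ^+ (des sigma).+1 * q ^+ occ_2_31 sigma).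
Proof.
move=> n; pose V m k := words x q m k + x * words x q m k.+1.
rewrite /Cfrac (@jfrac_path _ _ _ (fun k => bracket k 1 q)
                  (fun k => x * bracket k.+1 1 q) V) /=.
- case: n => [|n]; first by rewrite /V !words0 mulr0 addr0.
  rewrite /V words1 // wordsS bracket0 mul0r add0r -sum_perm_weight big_distrr /=.
  by apply: eq_bigr => sigma _; rewrite mulrA exprS.
- exact: bracket0.
- by move=> k; rewrite /cbeta /= mulr1.
- by move=> k; rewrite /V !words0 mulr0 addr0.
(* The bracket in [wordsS] at k is V(k-1) + V(k), and [calpha] is [k] + x [k+1] by [bracketSl]. At k
   = 0 the first identity fails, but its factor [0] vanishes. *)
move=> m k; rewrite /calpha /V !wordsS /= expr1n bracketSl.
case: k => [|k] /=; last by ring.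
by rewrite bracket0; ring.
Qed.
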